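(* Let $l_R>0$ and $l_O>0$ be real numbers and let $$X=\{p\in\mathbb{R}^2 : \|p\|>l_O+l_R\},$$ where $\|\cdot\|$ is the Euclidean norm and $X$ carries the subspace topology from $\mathbb{R}^2$. Then there exists an explicit optimal (motion planning) algorithm in $X$, that is, an explicit collection $\{s_i:U_i\to \mathrm{P}X\}_{i=1}^{k}$ with $k=\mathrm{TC}(X)$, where the $U_i$ are open subsets of $X\times X$ with $X\times X=\bigcup_{i=1}^k U_i$, and each $s_i$ is continuous and satisfies $s_i(x_1,x_2)(0)=x_1$ and $s_i(x_1,x_2)(1)=x_2$ for all $(x_1,x_2)\in U_i$.
   Context: For a topological space $X$, $\mathrm{P}X$ denotes the space of all continuous paths $\gamma:[0,1]\to X$, equipped with the compact-open topology. A continuous local algorithm on an open set $U\subset X\times X$ is a continuous map $s:U\to \mathrm{P}X$ with $s(x_1,x_2)(0)=x_1$ and $s(x_1,x_2)(1)=x_2$ for all $(x_1,x_2)\in U$. The topological complexity $\mathrm{TC}(X)$ is the least positive integer $m$ such that $X\times X$ can be covered by $m$ open subsets $U_1,\dots,U_m$, each of which admits a continuous local algorithm $s_i:U_i\to\mathrm{P}X$. If no such $m$ exists, $\mathrm{TC}(X)=\infty$. A collection $s=\{s_i:U_i\to \mathrm{P}X\}_{i=1}^k$ of continuous local algorithms on open sets $U_i$ covering $X\times X$ defines a (not necessarily continuous) motion planning algorithm $X\times X\to \mathrm{P}X$, by using on each $(x_1,x_2)$ the map $s_i$ with the least index $i$ such that $(x_1,x_2)\in U_i$. Such an algorithm is called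 optimal if $k=\mathrm{TC}(X)$. The space $X$ in the claim is the obstacle-free state space of a mobile robot of radius $l_R$ moving in the plane with an obstacle of radius $l_O$ centred at the origin. *)

(* Defs.v *)
From HB Require Import structures.
From mathcomp Require Import all_boot all_order all_algebra.
From mathcomp Require Import all_classical all_reals all_analysis.

Set Implicit Arguments.
Unset Strict Implicit.
Unset Printing Implicit Defensive.

Import Order.TTheory GRing.Theory Num.Theory.
Import numFieldNormedType.Exports.

Local Open Scope classical_set_scope.
Local Open Scope ring_scope.

Section PathSpace.
Context {R : realType}.

Definition unit_interval : set R := `[0, 1].

Lemma unit_interval0 : 0 \in unit_interval.
Proof. by rewrite inE /unit_interval /= in_itv /= lexx ler01. Qed.

Lemma unit_interval1 : 1 \in unit_interval.
Proof. by rewrite inE /unit_interval /= in_itv /= lexx ler01. Qed.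

Definition itv_start : unit_interval := exist _ 0 unit_interval0.
Definition itv_end : unit_interval := exist _ 1 unit_interval1.

End PathSpace.

Definition path_space (R : realType) (X : topologicalType) : Type :=
  continuousType (@unit_interval R) X.

(* The carrier of [{compact-open, I -> X}] is the type of all functions; the
   path space is the subspace of the continuous ones. *)
Definition path_fun (R : realType) (X : topologicalType)
  (g : path_space R X) : {compact-open, @unit_interval R -> X} := g.

HB.instance Definition _ (R : realType) (X : topologicalType) :=
  Choice.on (path_space R X).

HB.instance Definition _ (R : realType) (X : topologicalType) :=
  Topological.copy (path_space R X) (initial_topology (@path_fun R X)).

(* The domain [U] is coerced to its subtype, with the subspace topology. *)
Record local_algorithm (R : realType) (X : topologicalType)
    (U : set (X * X)%type) := LocalAlgorithm {
  local_map : U -> path_space R X ;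
  local_map_continuous : continuous local_map ;
  local_map_start : forall x : U,
    path_fun (local_map x) itv_start = (\val x).1 ;
  local_map_end : forall x : U,
    path_fun (local_map x) itv_end = (\val x).2 }.

Record algorithm_collection (R : realType) (X : topologicalType) (k : nat) :=
  AlgorithmCollection {
  domain : 'I_k -> set (X * X)%type ;
  domain_open : forall i, open (domain i) ;
  domain_cover : \bigcup_(i in [set: 'I_k]) domain i = [set: X * X] ;
  algorithm : forall i, local_algorithm R (domain i) }.

Definition admits_collection (R : realType) (X : topologicalType) (m : nat) :
  Prop := (0 < m)%N /\ inhabited (algorithm_collection R X m).

(* [None] stands for infinity. *)
Definition TC (R : realType) (X : topologicalType) : option nat :=
  match pselect (exists m, `[< admits_collection R X m >]) with
  | left h => Some (ex_minn h)
  | right _ => None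
  end.

Definition optimal (R : realType) (X : topologicalType) (k : nat)
  (s : algorithm_collection R X k) : Prop := TC R X = Some k.

Section StateSpace.
Context {R : realType}.
Implicit Types (p q : 'rV[R]_2) (t : R).

(* The norm [`|p|] of the library is the maximum norm on row vectors; it
   induces the same topology. *)
Definition enorm p : R := Num.sqrt (\sum_(i < 2) p ord0 i ^+ 2).

Definition state_space (lO lR : R) : set 'rV[R]_2 := [set p | lO + lR < enorm p].

Definition direction p : 'rV[R]_2 := (enorm p)^-1 *: p.

(* Polar interpolation: the radius is interpolated linearly, and the direction
   runs over the shorter circular arc, as the normalized linear interpolation of
   the two directions.  It is a path from [p] to [q] when the directions of [p]
   and [q] are not opposite. *)
Definition short_arc p q t : 'rV[R]_2 :=
  ((1 - t) * enorm p + t * enorm q) *: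
    direction ((1 - t) *: direction p + t *: direction q).

Definition quarter_turn p : 'rV[R]_2 :=
  \row_(j < 2) (if j == ord0 then - p ord0 ord_max else p ord0 ord0).

(* The counterclockwise half circle from [p] to [- p]. *)
Definition half_circle p t : 'rV[R]_2 :=
  cos (pi * t) *: p + sin (pi * t) *: quarter_turn p.

(* First from [p] to [- q], then from [- q] to [q]; a path from [p] to [q] when
   [p] and [q] have different directions. *)
Definition detour p q t : 'rV[R]_2 :=
  if t <= 2^-1 then short_arc p (- q) (2 * t)
  else half_circle (- q) (2 * t - 1).

End StateSpace.

(* The two local algorithms are given by closed formulas: [short_arc] on the
   pairs of points with non-opposite directions, [detour] on the pairs of points
   with different directions. *)
Definition given_by_formulas (R : realType) (lO lR : R)
    (s : algorithm_collection R (state_space lO lR) 2) : Prop :=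
  [/\ domain s ord0 =
        [set x | direction (\val x.1) <> - direction (\val x.2)],
      domain s ord_max =
        [set x | direction (\val x.1) <> direction (\val x.2)],
      forall (x : domain s ord0) (t : @unit_interval R),
        \val (path_fun (local_map (algorithm s ord0) x) t) =
          short_arc (\val (\val x).1) (\val (\val x).2) (\val t) &
      forall (x : domain s ord_max) (t : @unit_interval R),
        \val (path_fun (local_map (algorithm s ord_max) x) t) =
          detour (\val (\val x).1) (\val (\val x).2) (\val t)].

(* Main.v *)
Require Import Defs.
From HB Require Import structures.
From mathcomp Require Import all_boot all_order all_algebra.
From mathcomp Require Import all_classical all_reals all_analysis.
From mathcomp Require Import ring lra.

Import Order.TTheory GRing.Theory Num.Theory.
Import numFieldNormedType.Exports.

Local Open Scope classical_set_scope.
Local Open Scope ring_scope.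

(** Outside a disc, two points with opposite directions have no preferred short
    arc between them; this is the only failure of [short_arc].  As [detour] starts
    with a short arc towards the antipode of the goal, it fails only for equal
    directions.  No pair of points is of both kinds, so the two formulas together
    form a collection of two algorithms.  Both formulas keep the distance to the
    origin above the threshold, since the radius is either interpolated between
    two admissible radii or kept constant on a half circle; both are jointly
    continuous in the two points and the time ([cvg_short_arc], [cvg_detour]),
    and currying a jointly continuous map gives a continuous map into the path
    space ([local_algorithm_of_formula]).

    One algorithm is not enough.  A continuous algorithm [s] defined on all pairs,
    applied to a fixed point and to a point that runs around a circle, would
    contract this circle to the fixed point while avoiding the origin
    ([no_global_algorithm]).  This is excluded by a discrete winding number
    ([circle_not_null_homotopic]).  By compactness the circle can be cut into
    equal arcs so short that, at every time of the homotopy, consecutive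
    subdivision points are seen from the origin under an acute angle.  The sum of
    these signed angles depends continuously on the time; as the subdivided loop
    closes up, its cosine is positive ([cos_turn_sum_gt0]).  It is 0 for the
    constant loop and 2 pi for the circle, so in between it would take the value
    pi, whose cosine is - 1. *)

(** * A discrete winding number *)

(** The signed angle from (x, y) to (x', y'): the quotient is that of the cross
    product by the dot product, so this is the expected angle when the dot product
    is positive. *)
Definition turn {R : realType} (x y x' y' : R) : R :=
  atan ((x * y' - y * x') / (x * x' + y * y')).

(** As the angle is acute, rotating (x, y) by it gives a positive multiple of
    (x', y'). *)
Lemma turnP (R : realType) (x y x' y' : R) (a := turn x y x' y') :
  0 < x * x' + y * y' ->
  exists2 r, 0 < r & x' = r * (x * cos a - y * sin a) /\
                     y' = r * (x * sin a + y * cos a).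
Proof.
move=> d0; set d := x * x' + y * y' in d0.
have ca : 0 < cos a by apply: cos_gt0_pihalf; rewrite atan_gtNpi2 atan_ltpi2.
have sa : sin a = (x * y' - y * x') / d * cos a.
  by rewrite -[(_ - _) / _]atanK /tan divfK ?gt_eqF.
have n0 : 0 < x ^+ 2 + y ^+ 2.
  rewrite lt_neqAle addr_ge0 ?sqr_ge0// andbT eq_sym paddr_eq0 ?sqr_ge0//.
  apply/negP => /andP[]; rewrite !sqrf_eq0 => /eqP x0 /eqP y0.
  by move: d0; rewrite /d x0 y0 !mul0r addr0 ltxx.
exists (d / (cos a * (x ^+ 2 + y ^+ 2))); first by rewrite divr_gt0 ?mulr_gt0.
rewrite sa.
have [dn cn nn] : [/\ d != 0, cos a != 0 & x ^+ 2 + y ^+ 2 != 0].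
  by rewrite !gt_eqF.
by split; rewrite /d; field; rewrite -/d dn cn nn.
Qed.

(** Rotations and positive homotheties commute, so the steps of a broken line
    compose to the rotation by the sum of the angles, up to a positive factor. *)
Lemma turn_sumP (R : realType) (x y : nat -> R) (n : nat)
    (a := \sum_(i < n) turn (x i) (y i) (x i.+1) (y i.+1)) :
  (forall i, (i < n)%N -> 0 < x i * x i.+1 + y i * y i.+1) ->
  exists2 r, 0 < r & x n = r * (x 0%N * cos a - y 0%N * sin a) /\
                     y n = r * (x 0%N * sin a + y 0%N * cos a).
Proof.
rewrite {}/a; elim: n => [|n IH] d0.
  exists 1 => //; rewrite big_ord0 cos0 sin0; split; ring.
have [r r0 [xn yn]] := IH (fun i h => d0 i (ltnW h)).
have [r' r'0 [xn1 yn1]] := turnP _ _ _ _ _ (d0 n (ltnSn n)).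
rewrite big_ord_recr /=; set a := \sum_(i < n) _ in xn yn *.
set b := turn _ _ _ _ in xn1 yn1 *.
exists (r * r'); first exact: mulr_gt0.
by rewrite cosD sinD xn1 yn1 xn yn; split; ring.
Qed.

(** The total rotation sends the starting point of a closed broken line to a
    positive multiple of itself, so its angle is a multiple of 2 pi. *)
Lemma cos_turn_sum_gt0 (R : realType) (x y : nat -> R) (n : nat) :
  0 < x 0%N ^+ 2 + y 0%N ^+ 2 -> x n = x 0%N -> y n = y 0%N ->
  (forall i, (i < n)%N -> 0 < x i * x i.+1 + y i * y i.+1) ->
  0 < cos (\sum_(i < n) turn (x i) (y i) (x i.+1) (y i.+1)).
Proof.
move=> n0 xn yn /turn_sumP[r r0]; rewrite xn yn; set a := \sum_(i < n) _.
move=> [ex ey]; have : x 0%N ^+ 2 + y 0%N ^+ 2 =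
    r * cos a * (x 0%N ^+ 2 + y 0%N ^+ 2).
  rewrite {1}expr2 {2}ex {1}expr2 {2}ey; ring.
rewrite -{1}[_ + _]mul1r => /(mulIf (lt0r_neq0 n0)) rc.
by rewrite -(pmulr_rgt0 _ r0) -rc.
Qed.

Lemma turn_circle (R : realType) (c u v : R) :
  c != 0 -> - (pi / 2) < v < pi / 2 ->
  turn (c * cos u) (c * sin u) (c * cos (u + v)) (c * sin (u + v)) = v.
Proof.
move=> c0 vI; rewrite /turn cosD sinD.
have cu := cos2Dsin2 u.
have cv : cos v != 0 by rewrite gt_eqF // cos_gt0_pihalf.
rewrite (_ : _ / _ = tan v).
  by rewrite tanK // in_itv.
set d := (X in _ / X); have dE : d = c ^+ 2 * cos v.
  by rewrite -[RHS]mulr1 -cu /d; ring.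
rewrite dE /tan; apply/eqP; rewrite eqr_div ?mulf_neq0 ?sqrf_eq0 //; apply/eqP.
by rewrite -[RHS]mulr1 -cu; ring.
Qed.

(** For a zero step the dot product is the squared norm, hence positive; it
    stays positive for small steps near each parameter, and compactness of the
    square makes the bound on the step uniform. *)
Lemma uniform_acute_step (R : realType) (x y : R * R -> R) :
  continuous x -> continuous y ->
  (forall p : R * R, 0 <= p.2 <= 1 -> 0 < x p ^+ 2 + y p ^+ 2) ->
  \forall n \near \oo, forall s t : R, 0 <= s <= 1 -> 0 <= t <= 1 ->
    0 < x (s, t) * x (s + n.+1%:R^-1, t) + y (s, t) * y (s + n.+1%:R^-1, t).
Proof.
move=> cx cy n0.
have K : compact (`[0, 1]%classic `*` `[0, 1]%classic : set (R * R)).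
  by apply: compact_setX; exact: segment_compact.
pose P (n : nat) (p : R * R) :=
  0 < x p * x (p.1 + n.+1%:R^-1, p.2) + y p * y (p.1 + n.+1%:R^-1, p.2).
suff : \forall n \near \oo, `[0, 1]%classic `*` `[0, 1]%classic `<=` P n.
  apply: filterS => n Pn s t s01 t01.
  by apply: (Pn (s, t)); split; rewrite /= in_itv.
move/compact_near_coveringP : K; apply => -[s t] [/= _].
rewrite in_itv /= => t01.
have cvgp : (fun z : (R * R) * nat => (z.1.1 + z.2.+1%:R^-1, z.1.2)) @
    filter_prod (nbhs (s, t)) \oo --> (s, t).
  apply: (@cvg_pair _ _ _ (filter_prod (nbhs (s, t)) \oo) (nbhs s) (nbhs t));
    last by apply: cvg_comp; [exact: cvg_fst|exact: cvg_snd].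
  have -> : nbhs s = nbhs (s + 0) by rewrite addr0.
  apply: cvgD.
    by apply: cvg_comp; [exact: cvg_fst|exact: cvg_fst].
  apply: (cvg_comp snd (fun n : nat => n.+1%:R^-1 : R)); first exact: cvg_snd.
  exact: cvg_harmonic.
have : (fun z : (R * R) * nat => x z.1 * x (z.1.1 + z.2.+1%:R^-1, z.1.2) +
      y z.1 * y (z.1.1 + z.2.+1%:R^-1, z.1.2)) @
    filter_prod (nbhs (s, t)) \oo --> x (s, t) * x (s, t) + y (s, t) * y (s, t).
  apply: cvgD; apply: cvgM.
  - by apply: cvg_comp; [exact: cvg_fst|exact: cx].
  - by apply: (cvg_comp _ _ cvgp); exact: cx.
  - by apply: cvg_comp; [exact: cvg_fst|exact: cy].
  - by apply: (cvg_comp _ _ cvgp); exact: cy.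
by rewrite -!expr2 => /cvgr_gt /(_ _ (n0 (s, t) t01)).
Qed.

(** Here [s] runs along the loops and [t] is the time of the homotopy.  The sum of
    the angles between consecutive subdivision points would vary continuously from
    0 to 2 pi with a cosine that stays positive. *)
Lemma circle_not_null_homotopic (R : realType) (x y : R * R -> R) (a b c : R) :
  continuous x -> continuous y ->
  (forall p : R * R, 0 <= p.2 <= 1 -> 0 < x p ^+ 2 + y p ^+ 2) ->
  (forall t, x (1, t) = x (0, t) /\ y (1, t) = y (0, t)) ->
  (forall s, x (s, 0) = a /\ y (s, 0) = b) ->
  (forall s, x (s, 1) = c * cos (2 * pi * s) /\
             y (s, 1) = c * sin (2 * pi * s)) ->
  False.
Proof.
move=> cx cy n0 loop start stop.
have c0 : c != 0.
  apply/eqP => c0; have := n0 (0, 1); rewrite /= ler01 lexx => /(_ isT).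
  by have [-> ->] := stop 0; rewrite c0 !mul0r !expr2 !mul0r addr0 ltxx.
(* Five arcs at least, so that [atan] recovers the angle 2 pi / n.+1 of each arc
   of the circle. *)
have [n [n4 acute]] : exists n, (4 <= n)%N /\
    (forall s t : R, 0 <= s <= 1 -> 0 <= t <= 1 ->
    0 < x (s, t) * x (s + n.+1%:R^-1, t) + y (s, t) * y (s + n.+1%:R^-1, t)).
  near \oo => n; exists n; split; first by near: n; exact: nbhs_infty_ge.
  by near: n; exact: uniform_acute_step.
set N := n.+1 in acute; have N0 : N%:R != 0 :> R by rewrite pnatr_eq0.
pose f z t : R * R := (z%:R / N%:R, t).
have fS i t : f i.+1 t = (i%:R / N%:R + N%:R^-1, t).
  by rewrite /f -natr1 mulrDl mul1r.
have f01 i : (i <= N)%N -> 0 <= (i%:R / N%:R : R) <= 1.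
  move=> iN; apply/andP; split; first by rewrite divr_ge0 ?ler0n.
  by rewrite ler_pdivrMr ?ltr0Sn // mul1r ler_nat.
have dot_gt0 t i : 0 <= t <= 1 -> (i < N)%N ->
    0 < x (f i t) * x (f i.+1 t) + y (f i t) * y (f i.+1 t).
  by move=> t01 iN; rewrite fS; apply: acute => //; apply: f01; exact: ltnW.
pose w t := \sum_(i < N)
  turn (x (f i t)) (y (f i t)) (x (f i.+1 t)) (y (f i.+1 t)).
have cosw t : 0 <= t <= 1 -> 0 < cos (w t).
  move=> t01.
  apply: (@cos_turn_sum_gt0 R (fun i => x (f i t)) (fun i => y (f i t))).
  - exact: n0.
  - by rewrite /f divff // mul0r; have [] := loop t.
  - by rewrite /f divff // mul0r; have [] := loop t.
  - by move=> i; exact: dot_gt0.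
have w0 : w 0 = 0.
  rewrite /w big1 // => i _.
  have [-> ->] := start (i%:R / N%:R); have [-> ->] := start (i.+1%:R / N%:R).
  by rewrite /turn [b * a]mulrC subrr mul0r atan0.
have w1 : w 1 = 2 * pi.
  rewrite /w (eq_bigr (fun=> 2 * pi / N%:R)) => [|i _].
    by rewrite sumr_const card_ord -[LHS]mulr_natr divfK.
  rewrite fS.
  have [-> ->] := stop (i%:R / N%:R).
  have [-> ->] := stop (i%:R / N%:R + N%:R^-1).
  rewrite [2 * pi * (_ + _)]mulrDr turn_circle //.
  have pi0 := pi_gt0 R.
  have N5 : 5 <= N%:R :> R by rewrite (ler_nat _ 5).
  have N0' : 0 < N%:R :> R by lra.
  apply/andP; split.
    rewrite (@lt_trans _ _ 0) //; first by rewrite oppr_lt0 divr_gt0.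
    by rewrite divr_gt0 // mulr_gt0.
  rewrite ltr_pdivrMr //; nra.
have cw : {within `[0, 1], continuous w}.
  apply: continuous_in_subspaceT => t; rewrite inE /= in_itv /= => t01.
  have cf i : f i s @[s --> t] --> f i t.
    apply: (@cvg_pair _ _ _ (nbhs t) (nbhs _) (nbhs t)) => //; exact: cvg_cst.
  have cxf i : x (f i s) @[s --> t] --> x (f i t).
    by apply: (cvg_comp _ _ (cf i)); exact: cx.
  have cyf i : y (f i s) @[s --> t] --> y (f i t).
    by apply: (cvg_comp _ _ (cf i)); exact: cy.
  apply: cvg_big => [|i _]; first exact: add_continuous.
  rewrite /turn.
  apply: continuous_comp; last exact: continuous_atan.
  apply: cvgM; first by apply: cvgB; apply: cvgM.
  apply: cvgV; last by apply: cvgD; apply: cvgM.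
  by rewrite gt_eqF // dot_gt0.
have [t] : exists2 t, t \in `[0, 1] & w t = pi.
  apply: (@IVT R w 0 1 pi) => //; rewrite w0 w1.
  have pi0 := pi_gt0 R; rewrite ge_min le_max; lra.
rewrite in_itv /= => /cosw; move=> + wt; rewrite wt cospi; lra.
Unshelve. all: by end_near. Qed.

(** * Paths as functions of two variables *)

Lemma subtype_continuous (T X : topologicalType) (A : set X) (f : T -> A) :
  continuous (fun z => \val (f z)) -> continuous f.
Proof. exact: continuous_comp_initial. Qed.

Lemma subtype_val_continuous (X : topologicalType) (A : set X) :
  continuous (fun a : A => \val a).
Proof. exact: initial_continuous. Qed.

Lemma subtype_hausdorff (X : topologicalType) (A : set X) :
  hausdorff_space X -> hausdorff_space A.
Proof.
move=> hX p q pq; apply/val_inj/hX => B C pB qC.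
have [z [Bz Cz]] := pq _ _ (subtype_val_continuous _ _ _ _ pB)
  (subtype_val_continuous _ _ _ _ qC).
by exists (\val z).
Qed.

Lemma clamp_subproof (R : realType) (t : R) :
  Num.max 0 (Num.min 1 t) \in @unit_interval R.
Proof.
rewrite inE /unit_interval /= in_itv /= le_max lexx /=.
by rewrite ge_max ler01 ge_min lexx.
Qed.

(** The continuous retraction of the line onto the interval; it turns homotopies
    parametrized by the interval type into functions of two real variables. *)
Definition clamp01 {R : realType} (t : R) : @unit_interval R :=
  exist _ (Num.max 0 (Num.min 1 t)) (clamp_subproof R t).

Lemma clamp01_continuous (R : realType) : continuous (@clamp01 R).
Proof.
apply: subtype_continuous => t /=.
apply: continuous_max; first exact: cvg_cst.
by apply: continuous_min; first exact: cvg_cst.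
Qed.

Lemma clamp01_val (R : realType) (t : @unit_interval R) : clamp01 (\val t) = t.
Proof.
apply: val_inj; case: t => t /=; rewrite inE /unit_interval /= in_itv /=.
by move=> /andP[t0 t1]; rewrite min_r // max_r.
Qed.

Lemma unit_interval_compact (R : realType) : compact [set: @unit_interval R].
Proof.
have <- : clamp01 @` `[0, 1]%classic = [set: @unit_interval R].
  apply/seteqP; split=> // t _; exists (\val t); last exact: clamp01_val.
  by case: t => t /= /set_mem.
apply: continuous_compact; last exact: segment_compact.
exact/continuous_subspaceT/clamp01_continuous.
Qed.

(** Uncurrying preserves continuity for the compact-open topology because the
    interval is compact and Hausdorff. *)
Lemma path_eval_continuous (R : realType) (T X : topologicalType)
    (f : T -> path_space R X) :
  continuous f ->
  continuous (fun z : T * @unit_interval R => path_fun (f z.1) z.2).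
Proof.
move=> cf.
have hI : hausdorff_space (@unit_interval R).
  exact/subtype_hausdorff/Rhausdorff.
have lcI : locally_compact [set: @unit_interval R].
  move=> t _; exists setT; first by rewrite withinET; exact: filterT.
  by split; [exact: unit_interval_compact|exact: closedT].
rewrite (_ : (fun z => _) = uncurry (fun x => path_fun (f x))); last first.
  by apply/funext => -[].
apply: (@continuous_uncurry T (@unit_interval R) X
  (fun x => path_fun (f x))) => //.
- move=> x; apply: (@continuous_comp _ _ _ f (@path_fun R X)); first exact: cf.
  exact: initial_continuous.
- by move=> x; exact: (@cts_fun _ _ (f x)).
Qed.

(** Currying a jointly continuous map gives a continuous map into the function
    space with the compact-open topology, whose values are continuous paths. *)
Lemma local_algorithm_of_formula (R : realType) (V : topologicalType)
    (S : set V) (U : set ((S : Type) * (S : Type))) (phi : V -> V -> R -> V) :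
  (forall (x : U) (t : @unit_interval R),
    S (phi (\val (\val x).1) (\val (\val x).2) (\val t))) ->
  continuous (fun z : U * @unit_interval R =>
    phi (\val (\val z.1).1) (\val (\val z.1).2) (\val z.2)) ->
  (forall x : U, phi (\val (\val x).1) (\val (\val x).2) 0 = \val (\val x).1) ->
  (forall x : U, phi (\val (\val x).1) (\val (\val x).2) 1 = \val (\val x).2) ->
  exists s : local_algorithm R U, forall (x : U) (t : @unit_interval R),
    \val (path_fun (local_map s x) t) =
      phi (\val (\val x).1) (\val (\val x).2) (\val t).
Proof.
move=> inS cphi start stop.
pose F (z : U * @unit_interval R) : S :=
  exist _ (phi (\val (\val z.1).1) (\val (\val z.1).2) (\val z.2))
    (mem_set (inS z.1 z.2)).
have cF : continuous F by apply: subtype_continuous.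
have [ccF cFx] := continuous_curry cF.
pose m (x : U) : path_space R S := mkcts (cFx x).
have cm : continuous m by exact: continuous_comp_initial.
have m0 (x : U) : path_fun (m x) itv_start = (\val x).1.
  exact/val_inj/start.
have m1 (x : U) : path_fun (m x) itv_end = (\val x).2.
  exact/val_inj/stop.
by exists (LocalAlgorithm cm m0 m1).
Qed.

(** * There is no global algorithm *)

Lemma enormE (R : realType) (p : 'rV[R]_2) :
  enorm p = Num.sqrt (p ord0 ord0 ^+ 2 + p ord0 ord_max ^+ 2).
Proof.
rewrite /enorm big_ord_recr big_ord1 /=; congr (Num.sqrt (p _ _ ^+ 2 + _)).
exact: val_inj.
Qed.

Lemma enorm_gt0_coord (R : realType) (p : 'rV[R]_2) :
  0 < enorm p -> 0 < p ord0 ord0 ^+ 2 + p ord0 ord_max ^+ 2.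
Proof. by rewrite enormE sqrtr_gt0. Qed.

Lemma cvg_rV2 (R : realType) (T : Type) (F : set_system T) (FF : Filter F)
    (f : T -> 'rV[R]_2) (l : 'rV[R]_2) :
  (forall j, f x ord0 j @[x --> F] --> l ord0 j) -> f x @[x --> F] --> l.
Proof.
move=> fl; apply/cvg_ballP => e e0.
have near_j j : \forall x \near F, ball (l ord0 j) e (f x ord0 j).
  by move: (fl j) => /cvg_ballP /(_ e e0).
near=> x; rewrite /ball /=; split => // i j; rewrite ord1.
by move: j; near: x; exact: filter_forall.
Unshelve. all: by end_near. Qed.

Definition circle {R : realType} (c s : R) : 'rV[R]_2 :=
  \row_(j < 2)
    (if j == ord0 then c * cos (2 * pi * s) else c * sin (2 * pi * s)).

Lemma circle_continuous (R : realType) (c : R) : continuous (circle c).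
Proof.
have lin : continuous (fun s : R => 2 * pi * s).
  by move=> s; apply: cvgM; [exact: cvg_cst|exact: cvg_id].
move=> s; apply: cvg_rV2 => j.
rewrite (_ : (fun x => _) = fun x =>
  if j == ord0 then c * cos (2 * pi * x) else c * sin (2 * pi * x)); last first.
  by apply/funext => x; rewrite mxE.
rewrite mxE; case: ifP => _; apply: cvgM; try exact: cvg_cst.
  by apply: (cvg_comp _ _ (lin s)); exact: continuous_cos.
by apply: (cvg_comp _ _ (lin s)); exact: continuous_sin.
Qed.

Lemma enorm_circle (R : realType) (c s : R) : 0 <= c -> enorm (circle c s) = c.
Proof.
move=> c0; rewrite enormE !mxE /= !exprMn -mulrDr.
by rewrite cos2Dsin2 mulr1 sqrtr_sqr ger0_norm.
Qed.

(** The homotopy follows the path that the algorithm chooses from a fixed point of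
    a circle to a point moving along that circle. *)
Lemma no_global_algorithm (R : realType) (lO lR : R)
    (U : set ((state_space lO lR : Type) * (state_space lO lR : Type))) :
  0 <= lO + lR -> U = setT -> local_algorithm R U -> False.
Proof.
set r := lO + lR; move=> r0 UT s.
have circle_in t : circle (r + 1) t \in state_space lO lR.
  by rewrite inE /state_space /= enorm_circle ?ltrDl // addr_ge0.
pose e t : state_space lO lR := exist _ (circle (r + 1) t) (circle_in t).
have eU t : (e 0, e t) \in U by rewrite UT inE.
pose g t : U := exist _ (e 0, e t) (eU t).
have ce : continuous e by apply: subtype_continuous; exact: circle_continuous.
have cg : continuous g.
  apply: subtype_continuous => t /=.
  apply: (@cvg_pair _ _ _ (nbhs t) (nbhs _) (nbhs _)); first exact: cvg_cst.
  exact: ce.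
pose h (z : R * R) : 'rV[R]_2 :=
  \val (path_fun (local_map s (g z.1)) (clamp01 z.2)).
have clg : continuous (fun t => local_map s (g t)).
  by move=> t; apply: (continuous_comp (cg t)); exact: local_map_continuous.
have ch : continuous h.
  move=> z; apply: (@continuous_comp _ _ _
    (fun z : R * R => path_fun (local_map s (g z.1)) (clamp01 z.2)));
    last exact: subtype_val_continuous.
  apply: (@continuous_comp _ _ _ (fun z : R * R => (z.1, clamp01 z.2))
     (fun z => path_fun (local_map s (g z.1)) z.2)).
    apply: (@cvg_pair _ _ _ (nbhs z) (nbhs _) (nbhs _)); first exact: cvg_fst.
    by apply: (cvg_comp _ _ cvg_snd); exact: clamp01_continuous.
  exact: (path_eval_continuous _ _ _ _ clg).
have chj j : continuous (fun z => h z ord0 j).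
  move=> z; apply: (@continuous_comp _ _ _ h (fun q : 'rV_2 => q ord0 j)).
    exact: ch.
  exact: coord_continuous.
have g10 : g 1 = g 0.
  apply/val_inj => /=; congr (_, _); apply/val_inj/rowP => j /=.
  by rewrite !mxE mulr1 mulr0 cos0 sin0 mulr_natl cos2pi sin2pi.
have clamp0 : clamp01 0 = itv_start :> @unit_interval R.
  by apply/val_inj; rewrite /= min_r ?maxxx.
have clamp1 : clamp01 1 = itv_end :> @unit_interval R.
  by apply/val_inj; rewrite /= minxx max_r.
apply: (@circle_not_null_homotopic R (fun z => h z ord0 ord0)
  (fun z => h z ord0 ord_max) (circle (r + 1) 0 ord0 ord0)
  (circle (r + 1) 0 ord0 ord_max) (r + 1)) => //.
- move=> z _; apply: enorm_gt0_coord; apply: (le_lt_trans r0).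
  by rewrite /h; case: (path_fun _ _) => q /= /set_mem.
- by move=> t; rewrite /h /= g10.
- by move=> t; rewrite /h /= clamp0 local_map_start.
- by move=> t; rewrite /h /= clamp1 local_map_end /= !mxE.
Qed.

(** * Norms and directions in the plane *)

Section Plane.
Context {R : realType}.
Implicit Types (p q : 'rV[R]_2) (t : R).

Lemma enorm_ge0 p : 0 <= enorm p. Proof. exact: sqrtr_ge0. Qed.

Lemma enormZ (a : R) p : enorm (a *: p) = `|a| * enorm p.
Proof.
by rewrite !enormE !mxE !exprMn -mulrDr sqrtrM ?sqr_ge0 // sqrtr_sqr.
Qed.

Lemma enormN p : enorm (- p) = enorm p.
Proof. by rewrite -scaleN1r enormZ normrN1 mul1r. Qed.

Lemma enorm_gt0 p : (0 < enorm p) = (p != 0).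
Proof.
rewrite lt_neqAle enorm_ge0 andbT eq_sym; congr (~~ _); apply/eqP/eqP.
  rewrite enormE => /eqP; rewrite sqrtr_eq0 => n0.
  have /eqP : p ord0 ord0 ^+ 2 + p ord0 ord_max ^+ 2 = 0.
    by apply/eqP; rewrite eq_le n0 addr_ge0 ?sqr_ge0.
  rewrite paddr_eq0 ?sqr_ge0 // !sqrf_eq0 => /andP[/eqP p0 /eqP p1].
  apply/rowP => j; rewrite mxE; case: (ord_max =P j) => [<- //|].
  case: j => -[|[|//]] jlt jmax; last by case: jmax; exact: val_inj.
  by rewrite -{}p0; congr (p _ _); exact: val_inj.
by move=> ->; rewrite -(scale0r 0) enormZ normr0 mul0r.
Qed.

Lemma enorm_direction p : p != 0 -> enorm (direction p) = 1.
Proof.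
rewrite -enorm_gt0 => p0; rewrite enormZ ger0_norm ?invr_ge0 ?enorm_ge0 //.
by rewrite mulVf ?gt_eqF.
Qed.

Lemma direction_neq0 p : p != 0 -> direction p != 0.
Proof. by move=> p0; rewrite -enorm_gt0 enorm_direction. Qed.

Lemma enorm_scale_direction p : p != 0 -> enorm p *: direction p = p.
Proof.
by rewrite -enorm_gt0 => p0; rewrite scalerA mulfV ?scale1r ?gt_eqF.
Qed.

Lemma directionN p : direction (- p) = - direction p.
Proof. by rewrite /direction enormN scalerN. Qed.

Lemma direction_idem p : p != 0 -> direction (direction p) = direction p.
Proof.
by move=> p0; rewrite {1}/direction enorm_direction // invr1 scale1r.
Qed.

(** If the interpolation of two unit vectors vanishes, its two terms have equal
    norms 1 - t and t, so t is 1/2 and the vectors are opposite. *)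
Lemma interpolation_neq0 p q t : enorm p = 1 -> enorm q = 1 -> p <> - q ->
  0 <= t <= 1 -> (1 - t) *: p + t *: q != 0.
Proof.
move=> p1 q1 pq /andP[t0 t1]; apply/eqP => /eqP; rewrite addr_eq0 => /eqP e.
have t12 : t = 2^-1.
  have := congr1 enorm e; rewrite enormN !enormZ p1 q1 !mulr1.
  rewrite !ger0_norm ?subr_ge0 //; lra.
apply: pq; move: e; rewrite t12 (_ : 1 - 2^-1 = 2^-1 :> R); last by field.
by rewrite -scalerN => /scalerI; apply; rewrite invr_eq0 pnatr_eq0.
Qed.

Lemma enorm_short_arc p q t : p != 0 -> q != 0 ->
  direction p <> - direction q -> 0 <= t <= 1 ->
  enorm (short_arc p q t) = (1 - t) * enorm p + t * enorm q.
Proof.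
move=> p0 q0 pq t01; rewrite enormZ enorm_direction ?mulr1; last first.
  by apply: interpolation_neq0; rewrite ?enorm_direction.
case/andP: t01 => t0 t1.
by rewrite ger0_norm // addr_ge0 // mulr_ge0 ?enorm_ge0 // subr_ge0.
Qed.

Lemma short_arc0 p q : p != 0 -> short_arc p q 0 = p.
Proof.
move=> p0; rewrite /short_arc subr0 !mul1r mul0r addr0 !scale1r scale0r addr0.
by rewrite direction_idem // enorm_scale_direction.
Qed.

Lemma short_arc1 p q : q != 0 -> short_arc p q 1 = q.
Proof.
move=> q0; rewrite /short_arc subrr !mul1r mul0r add0r !scale1r scale0r add0r.
by rewrite direction_idem // enorm_scale_direction.
Qed.

Lemma enorm_half_circle p t : enorm (half_circle p t) = enorm p.
Proof.
rewrite !enormE !mxE /=; congr Num.sqrt; set c := cos _; set s := sin _.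
have cs : c ^+ 2 + s ^+ 2 = 1 by exact: cos2Dsin2.
by rewrite -[RHS]mul1r -cs; ring.
Qed.

Lemma half_circle0 p : half_circle p 0 = p.
Proof.
by rewrite /half_circle mulr0 cos0 sin0 scale1r scale0r addr0.
Qed.

Lemma half_circle1 p : half_circle p 1 = - p.
Proof.
by rewrite /half_circle mulr1 cospi sinpi scaleN1r scale0r addr0.
Qed.

Lemma detour0 p q : p != 0 -> detour p q 0 = p.
Proof. by move=> p0; rewrite /detour invr_ge0 ler0n mulr0 short_arc0. Qed.

Lemma detour1 p q : detour p q 1 = q.
Proof.
rewrite /detour ifF; last by apply/negP; lra.
by rewrite (_ : 2 * 1 - 1 = 1 :> R) ?half_circle1 ?opprK //; ring.
Qed.

(** Each of the two pieces is frozen at the common point - q while the other one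
    runs; counting that point twice is compensated by adding q.  This form has no
    case distinction, so its continuity follows from that of the pieces. *)
Lemma detourE p q t : q != 0 -> detour p q t =
  short_arc p (- q) (Num.min (2 * t) 1) +
  half_circle (- q) (Num.max (2 * t - 1) 0) + q.
Proof.
move=> q0; rewrite /detour; case: ifPn => [t12|]; last rewrite -ltNge => t12.
  rewrite min_l; last by lra.
  by rewrite max_r ?half_circle0 ?subrK //; lra.
rewrite min_r; last by lra.
rewrite max_l; last by lra.
by rewrite short_arc1 ?oppr_eq0 // addrAC addNr add0r.
Qed.

End Plane.

(** * Continuity of the formulas *)

Section Continuity.
Context {R : realType} {T : Type} {F : set_system T} {FF : Filter F}.
Implicit Types (f g : T -> 'rV[R]_2) (h : T -> R) (p q : 'rV[R]_2) (t : R).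

Lemma cvg_coord f p j :
  f x @[x --> F] --> p -> f x ord0 j @[x --> F] --> p ord0 j.
Proof.
move=> fp; apply: (cvg_comp f (fun q : 'rV_2 => q ord0 j) fp).
exact: coord_continuous.
Qed.

Lemma cvg_enorm f p :
  f x @[x --> F] --> p -> enorm (f x) @[x --> F] --> enorm p.
Proof.
move=> fp; rewrite enormE; under eq_fun do rewrite enormE.
apply: (@cvg_comp _ _ _ (fun x => f x ord0 ord0 ^+ 2 + f x ord0 ord_max ^+ 2)
  Num.sqrt); last exact: sqrt_continuous.
by apply: cvgD; rewrite expr2; under eq_fun do rewrite expr2;
  apply: cvgM; exact: cvg_coord.
Qed.

Lemma cvg_direction f p : p != 0 -> f x @[x --> F] --> p ->
  direction (f x) @[x --> F] --> direction p.
Proof.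
move=> p0 fp; apply: cvgZ => //; apply: cvgV; last exact: cvg_enorm.
by rewrite gt_eqF // enorm_gt0.
Qed.

Lemma cvg_short_arc f g h p q t : p != 0 -> q != 0 ->
  direction p <> - direction q -> 0 <= t <= 1 ->
  f x @[x --> F] --> p -> g x @[x --> F] --> q -> h x @[x --> F] --> t ->
  short_arc (f x) (g x) (h x) @[x --> F] --> short_arc p q t.
Proof.
move=> p0 q0 pq t01 fp gq ht.
have h1 : 1 - h x @[x --> F] --> 1 - t by apply: cvgB => //; exact: cvg_cst.
apply: cvgZ.
  by apply: cvgD; apply: cvgM => //; exact: cvg_enorm.
apply: cvg_direction.
  by apply: interpolation_neq0; rewrite ?enorm_direction.
by apply: cvgD; apply: cvgZ => //; exact: cvg_direction.
Qed.

Lemma cvg_half_circle f h p t : f x @[x --> F] --> p -> h x @[x --> F] --> t ->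
  half_circle (f x) (h x) @[x --> F] --> half_circle p t.
Proof.
move=> fp ht.
have pih : pi * h x @[x --> F] --> pi * t by apply: cvgM => //; exact: cvg_cst.
apply: cvgD; apply: cvgZ => //.
- by apply: (cvg_comp _ _ pih); exact: continuous_cos.
- by apply: (cvg_comp _ _ pih); exact: continuous_sin.
apply: cvg_rV2 => j; rewrite mxE; under eq_fun do rewrite mxE.
by case: ifP => _; [apply: cvgN|]; exact: cvg_coord.
Qed.

Lemma cvg_detour f g h p q t : p != 0 -> q != 0 ->
  direction p <> direction q -> 0 <= t <= 1 ->
  (\forall x \near F, g x != 0) ->
  f x @[x --> F] --> p -> g x @[x --> F] --> q -> h x @[x --> F] --> t ->
  detour (f x) (g x) (h x) @[x --> F] --> detour p q t.
Proof.
move=> p0 q0 pq t01 g0 fp gq ht; rewrite detourE //.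
have h2 : 2 * h x @[x --> F] --> 2 * t by apply: cvgM => //; exact: cvg_cst.
have gN : - g x @[x --> F] --> - q by exact: cvgN.
apply: (@cvg_trans _ ((short_arc (f x) (- g x) (Num.min (2 * h x) 1) +
  half_circle (- g x) (Num.max (2 * h x - 1) 0) + g x) @[x --> F])).
  by apply: near_eq_cvg; near=> x; rewrite detourE //; near: x.
apply: cvgD => //; apply: cvgD.
  apply: cvg_short_arc => //; rewrite ?oppr_eq0 ?directionN ?opprK //.
    by rewrite ge_min lexx orbT le_min ler01; lra.
  apply: (cvg_comp _ (fun u => Num.min u 1) h2).
  by apply: (@continuous_min R R id (cst 1)); [exact: cvg_id|exact: cvg_cst].
apply: cvg_half_circle => //.
apply: (cvg_comp _ (fun u => Num.max (u - 1) 0) h2).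
apply: (@continuous_max R R (fun u => u - 1) (cst 0)); last exact: cvg_cst.
by apply: cvgB; [exact: cvg_id|exact: cvg_cst].
Unshelve. all: by end_near. Qed.

End Continuity.

(** * The two algorithms on the state space *)

Section Algorithms.
Context {R : realType} {lO lR : R} (r_ge0 : 0 <= lO + lR).
Local Notation X := (state_space lO lR : Type).

Lemma state_space_neq0 (a : X) : \val a != 0.
Proof.
by rewrite -enorm_gt0; case: a => p /= /set_mem; exact: le_lt_trans.
Qed.

Lemma unit_interval_bounds (t : @unit_interval R) : 0 <= \val t <= 1.
Proof. by case: t => t /= /set_mem; rewrite /unit_interval /= in_itv. Qed.

Lemma radius_interpolation_gt (r u v t : R) :
  r < u -> r < v -> 0 <= t <= 1 -> r < (1 - t) * u + t * v.
Proof.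
move=> ru rv /andP[t0 t1]; have [uv|/ltW vu] := leP u v.
  by apply: (lt_le_trans ru); nra.
by apply: (lt_le_trans rv); nra.
Qed.

Lemma short_arc_in_state_space (p q : 'rV[R]_2) (t : R) :
  state_space lO lR p -> state_space lO lR q ->
  direction p <> - direction q -> 0 <= t <= 1 ->
  state_space lO lR (short_arc p q t).
Proof.
rewrite /state_space /= => Xp Xq pq t01.
rewrite enorm_short_arc //; first exact: radius_interpolation_gt.
- by rewrite -enorm_gt0 (le_lt_trans r_ge0).
- by rewrite -enorm_gt0 (le_lt_trans r_ge0).
Qed.

Lemma detour_in_state_space (p q : 'rV[R]_2) (t : R) :
  state_space lO lR p -> state_space lO lR q ->
  direction p <> direction q -> 0 <= t <= 1 ->
  state_space lO lR (detour p q t).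
Proof.
move=> Xp Xq pq t01; have XNq : state_space lO lR (- q).
  by rewrite /state_space /= enormN.
rewrite /detour; case: ifPn => t12.
  apply: short_arc_in_state_space => //; first by rewrite directionN opprK.
  by move: t01 => /andP[t0 t1]; apply/andP; split; lra.
by rewrite /state_space /= enorm_half_circle.
Qed.

Lemma endpoints_continuous (U : set (X * X)) :
  continuous (fun w : U * @unit_interval R => \val w.1).
Proof.
move=> z; apply: (@continuous_comp _ _ _ fst (fun u : U => \val u)).
  exact: cvg_fst.
exact: subtype_val_continuous.
Qed.

Lemma cvg_start (U : set (X * X)) (z : U * @unit_interval R) :
  \val (\val w.1).1 @[w --> z] --> \val (\val z.1).1.
Proof.
apply: (@continuous_comp _ _ _ (fun w : U * @unit_interval R => \val w.1)
  (fun x : X * X => \val x.1)); first exact: endpoints_continuous.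
apply: (@continuous_comp _ _ _ fst (fun a : X => \val a)); first exact: cvg_fst.
exact: subtype_val_continuous.
Qed.

Lemma cvg_goal (U : set (X * X)) (z : U * @unit_interval R) :
  \val (\val w.1).2 @[w --> z] --> \val (\val z.1).2.
Proof.
apply: (@continuous_comp _ _ _ (fun w : U * @unit_interval R => \val w.1)
  (fun x : X * X => \val x.2)); first exact: endpoints_continuous.
apply: (@continuous_comp _ _ _ snd (fun a : X => \val a)); first exact: cvg_snd.
exact: subtype_val_continuous.
Qed.

Lemma cvg_time (U : set (X * X)) (z : U * @unit_interval R) :
  \val w.2 @[w --> z] --> \val z.2.
Proof.
by apply: (cvg_comp _ _ cvg_snd); exact: subtype_val_continuous.
Qed.

Definition not_opposite : set (X * X) :=
  [set x | direction (\val x.1) <> - direction (\val x.2)].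

Definition not_aligned : set (X * X) :=
  [set x | direction (\val x.1) <> direction (\val x.2)].

Lemma direction_val_continuous : continuous (fun a : X => direction (\val a)).
Proof.
move=> a; apply: (@cvg_direction _ _ (nbhs a)).
  exact: state_space_neq0.
exact: subtype_val_continuous.
Qed.

Lemma open_neq (T : topologicalType) (f g : T -> 'rV[R]_2) :
  continuous f -> continuous g -> open [set x | f x <> g x].
Proof.
move=> cf cg.
rewrite (_ : [set x | _] = (fun x => f x - g x) @^-1` (~` [set 0])).
  apply: open_comp; first by move=> x _; apply: cvgB; [exact: cf|exact: cg].
  apply/closed_openC/accessible_closed_set1/hausdorff_accessible.
  exact: norm_hausdorff.
apply/seteqP; split=> x /= fg; apply: contra_not fg => /eqP.
  by rewrite subr_eq0 => /eqP.
by move/eqP=> ->; rewrite subrr.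
Qed.

Lemma direction1_continuous :
  continuous (fun x : X * X => direction (\val x.1)).
Proof.
move=> x; apply: (@continuous_comp _ _ _ fst (fun a : X => direction (\val a))).
  exact: cvg_fst.
exact: direction_val_continuous.
Qed.

Lemma direction2_continuous :
  continuous (fun x : X * X => direction (\val x.2)).
Proof.
move=> x; apply: (@continuous_comp _ _ _ snd (fun a : X => direction (\val a))).
  exact: cvg_snd.
exact: direction_val_continuous.
Qed.

Lemma not_opposite_open : open not_opposite.
Proof.
apply: open_neq; first exact: direction1_continuous.
by move=> x; apply: (@cvgN _ _ _ (nbhs x)); exact: direction2_continuous.
Qed.

Lemma not_aligned_open : open not_aligned.
Proof.
exact: open_neq direction1_continuous direction2_continuous.
Qed.

(** A direction that equals both a direction and its opposite would vanish. *)
Lemma not_opposite_or_not_aligned (x : X * X) : not_opposite x \/ not_aligned x.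
Proof.
have [e|ne] := eqVneq (direction (\val x.1)) (direction (\val x.2)); last first.
  by right; exact/eqP.
left; rewrite /not_opposite /= e => /eqP; apply/negP.
rewrite -addr_eq0 -mulr2n -scaler_nat scaler_eq0 pnatr_eq0 /=.
exact/direction_neq0/state_space_neq0.
Qed.

Lemma short_arc_algorithm :
  exists s : local_algorithm R not_opposite, forall x t,
    \val (path_fun (local_map s x) t) =
      short_arc (\val (\val x).1) (\val (\val x).2) (\val t).
Proof.
apply: local_algorithm_of_formula.
- move=> x t; apply: short_arc_in_state_space; rewrite ?unit_interval_bounds //.
  + exact: set_mem (valP (\val x).1).
  + exact: set_mem (valP (\val x).2).
  + exact: set_mem (valP x).
- move=> z; apply: cvg_short_arc;
    rewrite ?state_space_neq0 ?unit_interval_bounds //.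
  + exact: set_mem (valP z.1).
  + exact: cvg_start.
  + exact: cvg_goal.
  + exact: cvg_time.
- by move=> x; rewrite short_arc0 ?state_space_neq0.
- by move=> x; rewrite short_arc1 ?state_space_neq0.
Qed.

Lemma detour_algorithm :
  exists s : local_algorithm R not_aligned, forall x t,
    \val (path_fun (local_map s x) t) =
      detour (\val (\val x).1) (\val (\val x).2) (\val t).
Proof.
apply: local_algorithm_of_formula.
- move=> x t; apply: detour_in_state_space; rewrite ?unit_interval_bounds //.
  + exact: set_mem (valP (\val x).1).
  + exact: set_mem (valP (\val x).2).
  + exact: set_mem (valP x).
- move=> z; apply: cvg_detour;
    rewrite ?state_space_neq0 ?unit_interval_bounds //.
  + exact: set_mem (valP z.1).
  + by apply: nearW => w; exact: state_space_neq0.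
  + exact: cvg_start.
  + exact: cvg_goal.
  + exact: cvg_time.
- by move=> x; rewrite detour0 ?state_space_neq0.
- by move=> x; rewrite detour1.
Qed.

Lemma formula_collection :
  exists s : algorithm_collection R (state_space lO lR) 2, given_by_formulas s.
Proof.
have [s0 s0E] := short_arc_algorithm; have [s1 s1E] := detour_algorithm.
pose D (i : 'I_2) := if i == ord0 then not_opposite else not_aligned.
have Do i : open (D i).
  by rewrite /D; case: ifP => _; [exact: not_opposite_open|
    exact: not_aligned_open].
have Dc : \bigcup_(i in [set: 'I_2]) D i = [set: X * X].
  apply/seteqP; split=> // x _.
  by have [?|?] := not_opposite_or_not_aligned x; [exists ord0|exists ord_max].
pose alg (i : 'I_2) : local_algorithm R (D i) :=
  if i == ord0 as b
    return local_algorithm R (if b then not_opposite else not_aligned)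
  then s0 else s1.
by exists (AlgorithmCollection Do Dc alg).
Qed.

(** Zero algorithms are excluded by definition, and a single one would have to be
    defined on all pairs. *)
Lemma TC_state_space : TC R (state_space lO lR) = Some 2.
Proof.
have [s _] := formula_collection.
have admits2 : admits_collection R (state_space lO lR) 2 by split.
rewrite /TC; case: pselect => [h|[]]; last by exists 2%N; apply/asboolP.
congr Some; case: ex_minnP => m /asboolP[m0 [s']] min_m; apply/eqP.
rewrite eqn_leq min_m; last exact/asboolP.
rewrite ltn_neqAle m0 andbT; apply/negP => /eqP m1.
case: _ / m1 s' => s'.
have UT : domain s' ord0 = setT.
  rewrite -(domain_cover s'); apply/seteqP; split=> x; first by exists ord0.
  by move=> [i _]; rewrite [i]ord1.
exact: (no_global_algorithm _ _ _ _ r_ge0 UT (algorithm s' ord0)).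
Qed.

End Algorithms.

Theorem mainTheorem2 (R : realType) (lR lO : R) (hR : 0 < lR) (hO : 0 < lO) :
  exists s : algorithm_collection R (state_space lO lR) 2,
    optimal s /\ given_by_formulas s.
Proof.
have r_ge0 : 0 <= lO + lR by rewrite addr_ge0 ?ltW.
have [s sE] := formula_collection r_ge0.
by exists s; split => //; exact: TC_state_space.
Qed.
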